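(* Let $n\ge 6$ and let $\mathcal F=\{A\subseteq[n]:\ A\neq\emptyset\text{ and for every }i\in A,\ i-1\in A\text{ or }i+1\in A\}$, i.e. the family of all nonempty unions of sets from $\{\{1,2\},\{2,3\},\dots,\{n-1,n\}\}$. Let $k$ be a positive integer with $k\le n-5$, and let $A\subseteq[n]$ with $A\notin\mathcal F$ and $|A|\le n-k-1$. Consider the conditions: (i) $\{1\}\subseteq A\subseteq\{1,3,4,\dots,n\}$; (ii) $\{n\}\subseteq A\subseteq\{1,2,\dots,n-2,n\}$; (iii) $\{1,2\}\subseteq A\subseteq\{1,2,\dots,n-1\}$ and $|A|=n-k-1$; (iv) $\{n-1,n\}\subseteq A\subseteq\{2,3,\dots,n\}$ and $|A|=n-k-1$; (v) $A\subseteq\{2,3,\dots,n-1\}$ and $|A|=n-k-1$; (vi) $\{1,2,n-1,n\}\subseteq A$ and $|A|=n-k-1$; (vii) $A\subseteq\{1,\dots,n-2\}$, $A\cap\{1,2\}\ne\emptyset$, $|A|=n-k-2$ and $A\setminus\{\max A\}\notin\mathcal F$; (viii) $A\subseteq\{3,\dots,n\}$, $A\cap\{n-1,n\}\neq\emptyset$, $|A|=n-k-2$ and $A\setminus\{\min A\}\notin\mathcal F$; (ix) $|A|=n-k-2$, $A\cap\{1,2\}\ne\emptyset$ and $A\cap\{n-1,n\}\ne\emptyset$; (x) $A\subseteq\{1,\dots,n-2\}$, $|A|=n-k-2$ and $A\setminus\{\max A\}\in\mathcal F$; (xi) $A\subseteq\{3,\dots,n\}$, $|A|=n-k-2$ and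 $A\setminus\{\min A\}\in\mathcal F$; (xii) $A\subseteq\{3,\dots,n-2\}$, $|A|=n-k-2$, and there is $j\in A$ with $\min A<j<\max A$ and $j-1,j+1\notin A$; (xiii) $A\subseteq\{3,\dots,n-2\}$, $|A|=n-k-2$, and for every $j\in A$ with $\min A<j<\max A$ we have $j-1\in A$ or $j+1\in A$; (xiv) $|A|\le n-k-3$. If $A$ satisfies any of (i), (ii), (vii), (viii), (ix), (xii), (xiv), then $A\notin\overline{\mathcal F}^{(k)}$. If $A$ satisfies any of (iii), (iv), (v), (vi), (x), (xi), (xiii), then $A\in\overline{\mathcal F}^{(k)}$.
   Context: A family of subsets of $[n]$ is union-closed over $[n]$ if it contains $[n]$ and is closed under pairwise unions. Convention: the empty set is never a member of any family considered; $2^{[n]}$ denotes the family of all nonempty subsets of $[n]$. The closure of a union-closed $\mathcal F$ is $\overline{\mathcal F}=\{A\in 2^{[n]}:\ \mathcal F\cup\{A\}\text{ is union-closed}\}$; iterated closures are $\overline{\mathcal F}^{(0)}=\mathcal F$, $\overline{\mathcal F}^{(i)}=\overline{\overline{\mathcal F}^{(i-1)}}$. $\max A$ and $\min A$ denote the largest and smallest elements of $A$. *)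

(* Defs.v *)
From mathcomp Require Import all_boot.

Set Implicit Arguments.
Unset Strict Implicit.
Unset Printing Implicit Defensive.

(* [n] = {1, ..., n} is carried by 'I_n, the ordinal x standing for the        *)
(* integer x.+1; everything below goes through these 1-based labels.           *)
Definition lbl n (x : 'I_n) : nat := x.+1.

(* i \in A for an arbitrary integer i; false for i = 0 and for i > n. *)
Definition has_elt n (A : {set 'I_n}) (i : nat) : bool :=
  [exists x in A, lbl x == i].

(* {a, a + 1, ..., b}, as a subset of [n]. *)
Definition seg n (a b : nat) : {set 'I_n} := [set x | a <= lbl x <= b].

(* 0 (resp. n) is only a junk value, taken on the empty set. *)
Definition max_elt n (A : {set 'I_n}) : nat := \max_(x in A) lbl x.
Definition min_elt n (A : {set 'I_n}) : nat := \big[minn/n]_(x in A) lbl x.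

Definition del n (A : {set 'I_n}) (i : nat) : {set 'I_n} :=
  [set x in A | lbl x != i].

Definition union_closed n (F : {set {set 'I_n}}) : bool :=
  ([set: 'I_n] \in F) && [forall B in F, forall C in F, B :|: C \in F].

(* Only nonempty sets are eligible: no family contains the empty set. *)
Definition uc_closure n (F : {set {set 'I_n}}) : {set {set 'I_n}} :=
  [set A | (A != set0) && union_closed (A |: F)].

Definition iter_closure n (k : nat) (F : {set {set 'I_n}}) : {set {set 'I_n}} :=
  iter k (@uc_closure n) F.

Definition path_family n : {set {set 'I_n}} :=
  [set A | (A != set0) &&
     [forall x in A, has_elt A (lbl x - 1) || has_elt A (lbl x + 1)]].

(* Main.v *)
(* Call x in A isolated if neither x - 1 nor x + 1 is in A, so that the path family F consists
   of the nonempty sets without isolated elements. The k-th closure of F can be described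
   completely: with m = n - k, it consists of the nonempty sets A such that A is in F, or
   |A| >= m, or |A| = m - 1 and neither 1 nor n is isolated in A, or |A| = m - 2 and each
   isolated element of A is either max A <= n - 2 or min A >= 3. For k = 0 this is F itself,
   and it passes from m to m - 1: a set of the new description joined with a member of the
   old one either does not grow or lands in the old one, while for any other A one adds a
   pair {y, y + 1} of F that enlarges A by one or two elements and leaves the offending
   element isolated and untolerated. *)

Require Import Defs.
From mathcomp Require Import all_boot zify.

Set Implicit Arguments.
Unset Strict Implicit.
Unset Printing Implicit Defensive.

Section Layers.

Variable n : nat.
Implicit Types (A B C : {set 'I_n}) (x y z w : 'I_n) (m : nat).

(** * Isolated elements and the path family *)

Definition adj x y : bool := (x.+1 == y) || (y.+1 == x).

Definition isolated A x : bool := (x \in A) && [forall y in A, ~~ adj x y].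

Lemma isolatedP A x :
  reflect (x \in A /\ forall y, y \in A -> ~~ adj x y) (isolated A x).
Proof.
apply: (iffP andP) => -[xA H]; split=> //; first exact/forall_inP.
exact/forall_inP.
Qed.

Lemma adjC x y : adj x y = adj y x.
Proof. by rewrite /adj orbC. Qed.

Lemma isolated_sub A B x : A \subset B -> x \in A -> isolated B x -> isolated A x.
Proof.
move=> /subsetP sAB xA /isolatedP[_ H]; apply/isolatedP; split=> // y /sAB.
exact: H.
Qed.

Lemma isolated_setU A B x :
  isolated (A :|: B) x -> isolated A x \/ isolated B x.
Proof.
move=> iso; have /isolatedP[/setUP[xA|xB] _] := iso.
  by left; apply: isolated_sub iso; rewrite ?subsetUl.
by right; apply: isolated_sub iso; rewrite ?subsetUr.
Qed.

Lemma isolated_addl A B x : isolated A x ->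
  (forall y, y \in B -> ~~ adj x y) -> isolated (A :|: B) x.
Proof.
move=> /isolatedP[xA HA] HB; apply/isolatedP; split; first by rewrite inE xA.
by move=> y /setUP[/HA|/HB].
Qed.

Lemma has_eltP A i : reflect (exists2 y, y \in A & lbl y = i) (has_elt A i).
Proof.
apply: (iffP existsP) => [[y /andP[yA /eqP yi]]|[y yA yi]]; exists y => //.
by rewrite yA yi eqxx.
Qed.

Lemma isolated_has_elt A x : isolated A x =
  [&& x \in A, ~~ has_elt A (lbl x - 1) & ~~ has_elt A (lbl x + 1)].
Proof.
apply/isolatedP/and3P => [[xA H]|[xA H1 H2]]; split=> //.
- by apply/has_eltP => -[y /H]; rewrite /adj /lbl; lia.
- by apply/has_eltP => -[y /H]; rewrite /adj /lbl; lia.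
move=> y yA; apply/negP => xy.
have [/eqP e|/eqP e] := orP xy.
  by case/has_eltP: H2; exists y; rewrite // /lbl; lia.
by case/has_eltP: H1; exists y; rewrite // /lbl; lia.
Qed.

Lemma path_familyP A : reflect (A != set0 /\ forall x, ~~ isolated A x)
  (A \in path_family n).
Proof.
rewrite inE; apply: (iffP andP) => -[nzA H]; split=> //.
  move=> x; rewrite isolated_has_elt -negb_or; apply/negP => /andP[xA].
  by move/forall_inP: H => /(_ x xA) ->.
apply/forall_inP => x xA; have := H x.
by rewrite isolated_has_elt xA /= -negb_or negbK.
Qed.

Lemma pair_path_family y z : adj y z -> [set y; z] \in path_family n.
Proof.
move=> yz; apply/path_familyP; split; first by apply/set0Pn; exists y; rewrite !inE eqxx.
move=> x; apply/negP => /isolatedP[] /set2P[->|->] H.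
  by have := H z; rewrite !inE eqxx orbT yz => /(_ isT).
by have := H y; rewrite !inE eqxx adjC yz => /(_ isT).
Qed.

Lemma not_path_family_isolated A : A != set0 -> A \notin path_family n ->
  exists x, isolated A x.
Proof.
move=> nzA nF; apply/existsP; apply: contraNT nF => /existsPn H.
exact/path_familyP.
Qed.

(* Ordinals are 0-based: the elements 1 and n of the paper are 0 and n.-1 here. *)
Definition isolated_inside A := forall x, isolated A x -> 0 < x < n.-1.

(** In labels the bounds are n - 2 and 3: past an extremal [x] there remains a place not adjacent to
    it. *)
Definition tolerated A x :=
  (x < n - 2 /\ forall y, y \in A -> y <= x) \/
  (1 < x /\ forall y, y \in A -> x <= y).

Definition isolated_extremal A := forall x, isolated A x -> tolerated A x.

Lemma isolated_insideU A B : isolated_inside A -> isolated_inside B ->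
  isolated_inside (A :|: B).
Proof. by move=> HA HB x /isolated_setU[/HA|/HB]. Qed.

Lemma setD1_neq0 A x : x \in A -> 1 < #|A| -> A :\ x != set0.
Proof. by move=> xA; rewrite (cardsD1 x A) xA ltnS card_gt0. Qed.

(** A second element of [A] keeps a maximum away from 1 and a minimum away from n; the bound in
    [tolerated] excludes the other end. *)
Lemma isolated_extremal_inside A : 1 < #|A| -> isolated_extremal A ->
  isolated_inside A.
Proof.
move=> A1 ext x isox; have /andP[xA _] := isox.
have /set0Pn[y /setD1P[yx yA]] : A :\ x != set0.
  exact: setD1_neq0.
have {}yx : (y : nat) <> x by move=> /val_inj e; rewrite e eqxx in yx.
have := ltn_ord y.
by case: (ext x isox) => -[x1 /(_ y yA)]; lia.
Qed.

Lemma path_family_inside A : A \in path_family n -> isolated_inside A.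
Proof. by case/path_familyP=> _ H x; rewrite (negPf (H x)). Qed.

(** * Layers, their monotonicity and unions of their members *)

Definition layer m A :=
  A != set0 /\ [\/ A \in path_family n, m <= #|A|,
    m = #|A|.+1 /\ isolated_inside A | m = #|A|.+2 /\ isolated_extremal A].

Lemma layer_inside m A : 3 < m -> layer m A -> #|A| < m -> isolated_inside A.
Proof.
move=> m3 [_ [/path_family_inside//||[]//|[Am ext]]] Alt; first by lia.
by apply: isolated_extremal_inside ext; lia.
Qed.

(** Each size case of [layer m] moves up by one, and the extremal case becomes the inside case
    because a tolerated element is never an end. *)
Lemma layer_pred m A : 3 < m -> layer m A -> layer m.-1 A.
Proof.
move=> m3 LA; have ins := layer_inside m3 LA.
case: LA => nzA [AF|mA|[mA _]|[mA _]]; split=> //; first by constructor 1.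
- by constructor 2; lia.
- by constructor 2; lia.
by constructor 3; split; [lia | apply: ins; lia].
Qed.

(* If A + y does not tolerate an isolated x that A does, then y lies beyond x and its iso_y
   possible neighbour in B is x itself. *)
Lemma isolated_extremalU1 A B y : B \in path_family n -> y \in B ->
  A :|: B = y |: A -> isolated_extremal A -> isolated_extremal (A :|: B).
Proof.
move=> BF yB AB ext x iso.
have /isolatedP[xAB nadj] := iso.
have isoA : isolated A x.
  case/isolated_setU: (iso) => // isoB.
  by case/path_familyP: BF => _ /(_ x); rewrite isoB.
have [z zB yz] : exists2 z, z \in B & adj y z.
  case/path_familyP: BF => _ /(_ y) /negP H.
  apply/exists_inP; apply: contra_notT H => /exists_inPn H.
  by apply/isolatedP; split.
have zAB : z \in A :|: B by rewrite inE zB orbT.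
have nxy : ~~ adj x y by apply: nadj; rewrite inE yB orbT.
have zA : z \in A.
  move: zAB; rewrite AB => /setU1P[zy|//].
  by move: yz; rewrite zy /adj; lia.
have nxz := nadj z zAB.
have zx : z <> x by move=> zx; rewrite zx adjC (negPf nxy) in yz.
have {}zx : (z : nat) <> x by move=> /val_inj.
case: (ext x isoA) => -[bx H]; [left|right]; split=> // u;
  rewrite AB => /setU1P[->|/H//]; move: (H z zA) nxy nxz yz; rewrite /adj; lia.
Qed.

(** Only unions with at most m - 2 elements need care, sizes [m] and m - 1 being settled directly.
    As [A] grows strictly, it is then in the path family or extremal of size m - 3; [B] is in the
    path family or of size m - 2, hence the whole union. In the remaining mixed case [B] adds a
    single element to [A]. *)
Lemma layerU m A B : 5 < m -> layer m.-1 A -> layer m B -> ~~ (B \subset A) ->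
  layer m (A :|: B).
Proof.
move=> m5 LA LB nBA.
have nzA : A :|: B != set0.
  by case: LA => /set0Pn[x xA] _; apply/set0Pn; exists x; rewrite inE xA.
have ltA : #|A| < #|A :|: B|.
  by apply: proper_card; rewrite properE subsetUl subUset subxx.
have leB : #|B| <= #|A :|: B| by apply: subset_leq_card; apply: subsetUr.
have ins : m = #|A :|: B|.+1 -> isolated_inside (A :|: B).
  move=> e; apply: isolated_insideU; last by apply: layer_inside LB _; lia.
  by apply: layer_inside LA _; lia.
split=> //.
have [|ltm] := leqP m #|A :|: B|; first by constructor 2.
have [e|ne] := eqVneq m #|A :|: B|.+1; first by constructor 3; split=> //; apply: ins.
case: LA => _ [AF|mA|[mA _]|[mA extA]]; [|lia|lia|].
- case: LB => _ [BF|mB|[mB _]|[mB extB]]; [|lia|lia|].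
    constructor 1; case/path_familyP: AF => _ HA; case/path_familyP: BF => _ HB.
    by apply/path_familyP; split=> // x; apply/negP => /isolated_setU[];
      apply/negP.
  have eB : B = A :|: B by apply/eqP; rewrite eqEcard subsetUr andTb; lia.
  by constructor 4; rewrite -eB.
constructor 4; split; first by lia.
case: LB => _ [BF|mB|[mB _]|[mB extB]]; [|lia|lia|].
  have [y yB nyA] := subsetPn nBA.
  apply: (@isolated_extremalU1 _ _ y) => //; apply/esym/eqP.
  rewrite eqEcard subUset sub1set inE yB orbT subsetUl !andTb cardsU1 nyA; lia.
have eB : B = A :|: B by apply/eqP; rewrite eqEcard subsetUr andTb; lia.
by rewrite -eB.
Qed.

(** * Enlarging a set while an element stays isolated *)

Lemma boundary_pair A (a b : nat) z w : z \in A -> w \notin A ->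
  a <= z <= b -> a <= w <= b ->
  exists y z', [/\ y \notin A, z' \in A, adj y z', a <= y <= b & a <= z' <= b].
Proof.
move=> zA wA zab wab.
(* Induction on the distance |z - w|, written with truncated subtractions: on the walk from [z]
   towards [w], the first step out of [A] gives the pair. *)
have [d] := ubnP (z - w + (w - z)); elim: d z zA zab => // d IH z zA zab lt.
have wz : (w : nat) <> z by move=> /val_inj e; rewrite e zA in wA.
pose t := if z < w then z.+1 else z.-1.
have tn : t < n by rewrite /t; have := ltn_ord w; have := ltn_ord z; case: ifP; lia.
have zt : adj (Ordinal tn) z by rewrite /adj /= /t; case: ifP; lia.
have tab : a <= t <= b by rewrite /t; case: ifP; lia.
have [tA|ntA] := boolP (Ordinal tn \in A); last by exists (Ordinal tn), z.
by apply: (IH _ tA tab); rewrite /= /t; move: lt; case: ifP; lia.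
Qed.

Definition side x z w := (z < x.-1 /\ w < x.-1) \/ (x.+1 < z /\ x.+1 < w).

(** Between [z] and [w], away from [x], some [y] outside [A] is adjacent to some [z'] in [A]; the
    pair of both adds only [y] and does not touch [x]. *)
Lemma isolated_extension A x z w : isolated A x -> z \in A -> w \notin A ->
  side x z w -> exists2 y, y \notin A &
    isolated (y |: A) x /\ exists2 B, B \in path_family n & A :|: B = y |: A.
Proof.
move=> isox zA wA sd.
have [y [z' [nyA z'A yz nxy]]] :
    exists y z', [/\ y \notin A, z' \in A, adj y z' & ~~ adj x y].
  case: sd => sd.
    have [||y [z' [? ? ? ? ?]]] := @boundary_pair A 0 (x - 2) z w zA wA; [lia|lia|].
    by exists y, z'; split=> //; rewrite /adj; lia.
  have [||y [z' [? ? ? ? ?]]] := @boundary_pair A x.+2 n z w zA wA.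
  - by have := ltn_ord z; lia.
  - by have := ltn_ord w; lia.
  by exists y, z'; split=> //; rewrite /adj; lia.
exists y => //; split.
  rewrite setUC; apply: isolated_addl => // u; rewrite inE => /eqP-> //.
exists [set y; z']; first exact: pair_path_family.
apply/setP => u; rewrite !inE.
by case: (u =P z') => [->|_]; rewrite ?z'A ?orbT ?orbF // orbC.
Qed.

(** * Sets kept out of the closure of a layer by a union with a member of the path family *)

Definition blocked m A :=
  exists2 B, B \in path_family n & ~~ (B \subset A) /\ ~ layer m (A :|: B).

Lemma blocked_extension m A x z w : isolated A x -> z \in A -> w \notin A ->
  side x z w ->
  (forall y, y \notin A -> isolated (y |: A) x -> ~ layer m (y |: A)) ->
  blocked m A.
Proof.
move=> isox zA wA sd H.
have [y nyA [iso [B BF AB]]] := isolated_extension isox zA wA sd.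
exists B => //; split; last by rewrite AB; apply: H.
apply: contraNN nyA => BA; have := setU11 y A.
by rewrite -AB (setUidPl BA).
Qed.

Lemma not_layer_small m A x : isolated A x -> #|A| + 2 < m -> ~ layer m A.
Proof.
move=> isox Am [_ [/path_familyP[_ /(_ x)]||[]|[]]]; rewrite ?isox //; lia.
Qed.

Lemma far_cases x w : w != x -> ~~ adj x w -> w < x.-1 \/ x.+1 < w.
Proof.
move=> wx; have {}wx : (w : nat) <> x by move=> /val_inj e; rewrite e eqxx in wx.
by rewrite /adj; lia.
Qed.

Lemma isolated_far A x z : isolated A x -> z \in A -> z != x ->
  z < x.-1 \/ x.+1 < z.
Proof. by move=> /isolatedP[_ H] zA zx; apply: far_cases; rewrite ?H. Qed.

Lemma isolated_other A x : isolated A x -> 1 < #|A| ->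
  exists2 z, z \in A & z < x.-1 \/ x.+1 < z.
Proof.
move=> isox; have /andP[xA _] := isox.
move=> /(setD1_neq0 xA)/set0Pn[z /setD1P[zx zA]].
by exists z => //; apply: isolated_far isox zA zx.
Qed.

Lemma card_adj x : #|[set y | adj x y]| <= (0 < x < n.-1).+1.
Proof.
(* The filter [i != x] removes the truncated predecessor of 0, and [i < n] the successor of the last
   element, so an end has one candidate only. *)
pose s : seq nat := [seq i <- [:: x.-1; x.+1] | (i < n) && (i != x)].
have sub : {subset [seq val y | y in [set y | adj x y]] <= s}.
  move=> _ /imageP[y + ->]; rewrite inE mem_filter !inE /adj /= => xy.
  by have := ltn_ord y; lia.
have := uniq_leq_size _ sub; rewrite size_image => H.
apply: leq_trans (H _) _.
  by rewrite map_inj_uniq ?enum_uniq //; apply: val_inj.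
rewrite /s /=; have := ltn_ord x.
by case: ifP; case: ifP => /=; lia.
Qed.

(** [A], the neighbours of [x] and the set counted here cover [n]. *)
Lemma isolated_outsiders A x : isolated A x ->
  n - #|A| - (0 < x < n.-1).+1 <=
  #|[set w | (w \notin A) && ((w < x.-1) || (x.+1 < w))]|.
Proof.
move=> isox; have /andP[xA _] := isox; set W := [set w | _].
pose N := [set y | adj x y]; have N2 : #|N| <= (0 < x < n.-1).+1 := card_adj x.
have : #|[set: 'I_n]| <= #|A :|: N :|: W|.
  apply: subset_leq_card; apply/subsetP => w _; rewrite !inE.
  case: (boolP (w \in A)) => //= nwA; case: (boolP (adj x w)) => //= nadj.
  by apply/orP; apply: far_cases => //; apply: contraNneq nwA => ->.
rewrite cardsT card_ord; clearbody N W.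
have [leAN _] := leq_card_setU A N; have [leW _] := leq_card_setU (A :|: N) W.
by move=> le; rewrite -subnDA leq_subLR; apply: leq_trans le (leq_trans leW _);
  rewrite leq_add2r (leq_trans leAN) ?leq_add2l.
Qed.

Lemma isolated_outsider A x : isolated A x ->
  #|A| + (0 < x < n.-1).+1 < n ->
  exists2 w, w \notin A & w < x.-1 \/ x.+1 < w.
Proof.
move=> isox ltn; have := isolated_outsiders isox; set W := [set w | _] => H.
have /set0Pn[w] : W != set0 by rewrite -card_gt0; lia.
by rewrite inE => /andP[wA /orP far]; exists w.
Qed.

(** All places away from an end [x] lie on one side of it, so an extension always exists; it has m -
    1 elements and an isolated end. *)
Lemma blocked_not_inside m A x : 5 < m <= n -> #|A|.+2 = m -> isolated A x ->
  ~ 0 < x < n.-1 -> blocked m A.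
Proof.
move=> mn Am isox nx.
have [z zA zx] : exists2 z, z \in A & z < x.-1 \/ x.+1 < z.
  by apply: isolated_other => //; lia.
have [w wA wx] : exists2 w, w \notin A & w < x.-1 \/ x.+1 < w.
  by apply: isolated_outsider => //; lia.
apply: (blocked_extension isox zA wA).
  by have := ltn_ord z; have := ltn_ord w; rewrite /side; lia.
move=> y yA iso [_ []]; rewrite ?cardsU1 ?yA.
- by case/path_familyP=> _ /(_ x); rewrite iso.
- by lia.
- by case=> _ /(_ x iso).
- by lia.
Qed.

(** If no element of [A] lay on the side of [w], then [x] would be extremal there, and [w] itself
    would supply the room that toleration asks for. *)
Lemma not_tolerated_side A x w : isolated A x -> ~ tolerated A x ->
  w < x.-1 \/ x.+1 < w -> exists2 z, z \in A & side x z w.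
Proof.
move=> isox ntol [wx|wx].
  have [/exists_inP[z zA zx]|/exists_inPn H] := boolP [exists z in A, z < x].
    exists z => //; left; split=> //.
    have [|//|] := isolated_far isox zA; last by lia.
    by apply: contraTneq zx => ->; rewrite ltnn.
  by case: ntol; right; split; [lia | move=> y /H; rewrite -leqNgt].
have [/exists_inP[z zA zx]|/exists_inPn H] := boolP [exists z in A, x < z].
  exists z => //; right; split=> //.
  have [||//] := isolated_far isox zA; last by lia.
  by apply: contraTneq zx => ->; rewrite ltnn.
case: ntol; left; split; first by have := ltn_ord w; lia.
by move=> y /H; rewrite -leqNgt.
Qed.

Lemma tolerated_sub A B x : A \subset B -> tolerated B x -> tolerated A x.
Proof.
by move=> /subsetP sAB [] [bx H]; [left|right]; split=> // y /sAB /H.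
Qed.

Lemma tolerated_dec A x : tolerated A x \/ ~ tolerated A x.
Proof.
have [/orP[]/andP[bx /forall_inP H]|ntol] := boolP
    ((x < n - 2) && [forall y in A, y <= x] || (1 < x) && [forall y in A, x <= y]).
- by left; left.
- by left; right.
by right=> -[] [bx /forall_inP H]; rewrite bx H ?orbT in ntol.
Qed.

(** The extension has m - 2 elements, and [x] is still not tolerated since toleration passes to
    subsets. *)
Lemma blocked_not_tolerated m A x : m <= n -> #|A|.+3 = m -> isolated A x ->
  ~ tolerated A x -> blocked m A.
Proof.
move=> mn Am isox ntol.
have [w wA wx] : exists2 w, w \notin A & w < x.-1 \/ x.+1 < w.
  by apply: isolated_outsider => //; lia.
have [z zA sd] := not_tolerated_side isox ntol wx.
apply: (blocked_extension isox zA wA sd) => y yA iso [_ []]; rewrite ?cardsU1 ?yA.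
- by case/path_familyP=> _ /(_ x); rewrite iso.
- by lia.
- by lia.
- by case=> _ /(_ x iso) /(tolerated_sub (subsetUr _ _)).
Qed.

Lemma far_pair x (i : nat) : i.+1 < n -> i.+1 < x.-1 \/ x.+1 < i ->
  exists2 B, B \in path_family n & [/\ #|B| <= 2,
    forall y, y \in B -> ~~ adj x y & forall y, y \in B -> i <= y <= i.+1].
Proof.
move=> iN ix; pose y := Ordinal (ltnW iN); pose z := Ordinal iN.
exists [set y; z]; first by apply: pair_path_family; rewrite /adj eqxx.
split; first by rewrite cards2; case: (y != z).
  by move=> u /set2P[] ->; rewrite /adj /=; lia.
by move=> u /set2P[] ->; rewrite /=; lia.
Qed.

(** One more element leaves the set too small for [layer m], so a hole on a side of [x] that meets
    [A] suffices. Otherwise a whole pair is added on a side free of [A]. *)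
Lemma blocked_small m A x : 5 < m <= n -> #|A| + 3 < m -> isolated A x ->
  blocked m A.
Proof.
move=> mn Am isox.
have /isolatedP[xA _] := isox.
(* A pair may bring the size up to m - 2; then the element [z] of [A] on the other side of [x]
   prevents [x] from being extremal in the union. *)
have far (i : nat) : i.+1 < n -> i.+1 < x.-1 \/ x.+1 < i ->
    (forall y, i <= y <= i.+1 -> y \notin A) ->
    #|A| + 4 < m \/ (exists2 z, z \in A & (i < x < z) || (z < x < i)) ->
    blocked m A.
  move=> iN ix iA Hz; have [B BF [B2 nadj Bi]] := far_pair iN ix.
  have /path_familyP[/set0Pn[y yB] _] := BF.
  have iso := isolated_addl isox nadj.
  have [le _] := leq_card_setU A B.
  exists B => //; split.
    by apply/subsetPn; exists y => //; apply/iA/Bi.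
  have [lt|ge] := ltnP (#|A :|: B| + 2) m; first exact: not_layer_small iso lt.
  case: Hz => [|[z zA zxy]]; first by lia.
  have yi := Bi y yB.
  move=> [_ [/path_familyP[_ /(_ x)]||[]|[]]]; rewrite ?iso //; [lia|lia|].
  move=> _ /(_ x iso) [] [_ H].
    by have := H y; have := H z; rewrite !inE zA yB orbT => /(_ isT) + /(_ isT); lia.
  by have := H y; have := H z; rewrite !inE zA yB orbT => /(_ isT) + /(_ isT); lia.
have [A1|A1] := leqP #|A| 1.
  have A_x y : y \in A -> y = x.
    move=> yA; apply/eqP; apply: contraLR A1 => yx; rewrite -ltnNge.
    by rewrite (cardsD1 x A) xA ltnS card_gt0; apply/set0Pn; exists y; rewrite !inE yx.
  (* The nearest pair not adjacent to [x] is [x - 3], [x - 2] below it or [x.+2], [x.+3] above it;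
     for [x < 3] the latter fits since n is at least 6. *)
  have [x3|x3] := leqP 3 x.
    apply: (far (x - 3)); [by have := ltn_ord x; lia|by lia| |by left; lia].
    by move=> y yx; apply/negP => /A_x yE; rewrite yE in yx; lia.
  apply: (far x.+2); [by lia|by lia| |by left; lia].
  by move=> y yx; apply/negP => /A_x yE; rewrite yE in yx; lia.
have [z zA zx] := isolated_other isox A1.
have done_side u v : u \in A -> v \notin A -> side x u v -> blocked m A.
  move=> uA vA sd; apply: (blocked_extension isox uA vA sd) => y yA iso.
  by apply: not_layer_small iso _; rewrite cardsU1 yA; lia.
(* At least n - |A| - 2 places outside [A] are not adjacent to [x], which is at least two here. *)
have [w1 [w2 [w1A w2A w1x w2x w12]]] : exists w1 w2, [/\ w1 \notin A, w2 \notin A,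
    w1 < x.-1 \/ x.+1 < w1, w2 < x.-1 \/ x.+1 < w2 & (w1 : nat) <> w2].
  have := isolated_outsiders isox; set W := [set w | _] => H.
  have /set0Pn[w1 w1W] : W != set0 by rewrite -card_gt0; lia.
  have /set0Pn[w2 /setD1P[w21 w2W]] : W :\ w1 != set0.
    by rewrite -card_gt0; move: H; rewrite (cardsD1 w1 W) w1W; lia.
  move: w1W w2W; rewrite !inE => /andP[w1A /orP w1x] /andP[w2A /orP w2x].
  by exists w1, w2; split=> // /val_inj e; rewrite e eqxx in w21.
have [sd1|nsd1] := boolP
    ((z < x.-1) && (w1 < x.-1) || (x.+1 < z) && (x.+1 < w1)).
  by apply: (done_side z w1) => //; rewrite /side; lia.
have [sd2|nsd2] := boolP
    ((z < x.-1) && (w2 < x.-1) || (x.+1 < z) && (x.+1 < w2)).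
  by apply: (done_side z w2) => //; rewrite /side; lia.
have w1n := ltn_ord w1; have w2n := ltn_ord w2.
have [opp|/exists_inPn nopp] := boolP
    [exists u in A, (u < x.-1) && (w1 < x.-1) || (x.+1 < u) && (x.+1 < w1)].
  by case/exists_inP: opp => u uA ux; apply: (done_side u w1) => //; rewrite /side; lia.
(* Both [w1] and [w2] now lie opposite to [z], on a side where [A] has no element; holding two such
   places, it has room for the nearest pair. *)
have [w1lt|w1gt] := ltnP w1 x.
  apply: (far (x - 3)); [by have := ltn_ord x; lia|by lia| |by right; exists z => //; lia].
  by move=> y yx; apply/negP => /nopp; lia.
apply: (far x.+2); [by lia|by lia| |by right; exists z => //; lia].
by move=> y yx; apply/negP => /nopp; lia.
Qed.

(** * The closure of a layer is the next layer *)

Lemma uc_closureP (G : {set {set 'I_n}}) A : union_closed G ->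
  reflect (A != set0 /\ forall B, B \in G -> ~~ (B \subset A) -> A :|: B \in G)
    (A \in uc_closure G).
Proof.
case/andP=> TG /forall_inP UG; rewrite inE; apply: (iffP andP) => -[nzA H]; split=> //.
  move=> B BG nBA; case/andP: H => _ /forall_inP /(_ A (setU11 _ _)).
  move/forall_inP => /(_ B); rewrite !inE BG orbT => /(_ isT) /orP[/eqP AB|//].
  by rewrite -AB subsetUr in nBA.
have HA B : B \in G -> A :|: B \in A |: G.
  move=> BG; rewrite !inE; have [BA|nBA] := boolP (B \subset A).
    by rewrite (setUidPl BA) eqxx.
  by rewrite H ?orbT.
rewrite /union_closed !inE TG orbT /=.
apply/forall_inP => B /setU1P[->|BG]; apply/forall_inP => C /setU1P[->|CG].
- by rewrite setUid setU11.
- exact: HA.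
- by rewrite setUC HA.
by rewrite inE (forall_inP (UG B BG) C CG) orbT.
Qed.

Definition is_layer m (G : {set {set 'I_n}}) := forall A, A \in G <-> layer m A.

Lemma layer_union_closed m G : 5 < m <= n -> is_layer m G -> union_closed G.
Proof.
move=> mn LG; apply/andP; split.
  apply/LG; split; first by rewrite -card_gt0 cardsT card_ord; lia.
  by constructor 2; rewrite cardsT card_ord; lia.
apply/forall_inP => B /LG LB; apply/forall_inP => C /LG LC; apply/LG.
have [CB|nCB] := boolP (C \subset B); first by rewrite (setUidPl CB).
by apply: layerU => //; [lia | apply: layer_pred => //; lia].
Qed.

(** Members of the new layer pass the union test by [layerU]. A set outside it is blocked, the three
    blocking lemmas covering sizes m - 2, m - 3 and at most m - 4. *)
Lemma is_layer_closure m G : 5 < m <= n -> is_layer m G ->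
  is_layer m.-1 (uc_closure G).
Proof.
move=> mn LG A; split.
  case/(uc_closureP _ (layer_union_closed mn LG)) => nzA H.
  have nblocked : ~ blocked m A.
    case=> B BF [nBA]; apply; apply/LG/H => //; apply/LG.
    by split; [case/path_familyP: BF | constructor 1].
  split=> //; have [AF|nAF] := boolP (A \in path_family n); first by constructor 1.
  have [x isox] := not_path_family_isolated nzA nAF.
  have [|lt] := leqP m.-1 #|A|; first by constructor 2.
  have [e|ne1] := eqVneq m #|A|.+2.
    constructor 3; split; first by lia.
    move=> y isoy; apply: contraT => /negP ny; case: nblocked.
    exact: blocked_not_inside isoy ny.
  have [e|ne2] := eqVneq m #|A|.+3.
    constructor 4; split; first by lia.
    move=> y isoy; case: (tolerated_dec A y) => // ntol; case: nblocked.
    by apply: blocked_not_tolerated isoy ntol; lia.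
  by case: nblocked; apply: blocked_small isox; lia.
move=> LA; apply/(uc_closureP _ (layer_union_closed mn LG)).
split; first by case: LA.
by move=> B /LG LB nBA; apply/LG; apply: layerU => //; lia.
Qed.

(** * The path family as the layer of index n, and the iteration *)

Lemma card_missing A (s : seq nat) : uniq s -> {in s, forall i, i < n} ->
  (forall y, y \in A -> (y : nat) \notin s) -> #|A| + size s <= n.
Proof.
move=> us sn As; rewrite -[leqRHS](size_iota 0 n) cardE -(size_map val) -size_cat.
apply: uniq_leq_size.
  rewrite cat_uniq us (map_inj_uniq val_inj) enum_uniq andbT /=.
  apply/hasPn => i si; apply/mapP => -[y]; rewrite mem_enum => /As + e.
  by rewrite -e si.
move=> i; rewrite mem_cat mem_iota => /orP[/mapP[y _ ->]|/sn] /=; rewrite ?add0n //.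
Qed.

(** For index n the size cases leave no isolated element, by counting absences: any isolated [x]
    misses a neighbour, an inside one misses two, and a tolerated one also misses an end of [n]
    beyond them. *)
Lemma is_layer_path_family : 4 < n -> is_layer n (path_family n).
Proof.
move=> n4 A; split=> [AF|LA].
  by split; [case/path_familyP: AF | constructor 1].
have ins := layer_inside (ltnW n4) LA.
case: LA => nzA H; apply: contraT => /(not_path_family_isolated nzA) [x isox].
have /isolatedP[xA nadj] := isox; have xn := ltn_ord x.
have miss (t : seq nat) : {in t, forall i, i < n} -> uniq t ->
    (forall y, y \in A -> ~~ adj x y -> (y : nat) \notin t) -> #|A| + size t <= n.
  by move=> tn ut At; apply: card_missing => // y yA; apply: At (nadj y yA).
have [An|An] := leqP n #|A|.
  suff: #|A| + size [:: if x < n.-1 then x.+1 else x.-1] <= n by rewrite [size _]/=; lia.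
  apply: miss => //.
    by move=> i; rewrite inE => /eqP->; case: ifP; lia.
  by move=> y _; rewrite inE /adj; case: ifP; lia.
have xx := ins An x isox.
have ux : uniq [:: x.-1; x.+1] by rewrite /= inE; lia.
case: H => [/path_familyP[_ /(_ x)/negP[]]//|nA|[nA _]|[nA ext]]; first by lia.
  suff: #|A| + size [:: x.-1; x.+1] <= n by rewrite [size _]/=; lia.
  apply: miss => //.
    by move=> i; rewrite !inE; lia.
  by move=> y _; rewrite !inE /adj; lia.
have [[xn2 H]|[x1 H]] := ext x isox.
  suff: #|A| + size [:: n.-1; x.-1; x.+1] <= n by rewrite [size _]/=; lia.
  apply: miss.
  - by move=> i; rewrite !inE; lia.
  - by rewrite cons_uniq ux !inE; lia.
  by move=> y /H; rewrite !inE /adj; lia.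
suff: #|A| + size [:: 0; x.-1; x.+1] <= n by rewrite [size _]/=; lia.
apply: miss.
- by move=> i; rewrite !inE; lia.
- by rewrite cons_uniq ux !inE; lia.
by move=> y /H; rewrite !inE /adj; lia.
Qed.

(** The bound on [k] makes the index at least 6 before each closure step, as [is_layer_closure]
    requires. *)
Lemma is_layer_iter k : k <= n - 5 -> 4 < n ->
  is_layer (n - k) (iter_closure k (path_family n)).
Proof.
elim: k => [|k IH] kn n4; first by rewrite subn0; apply: is_layer_path_family.
rewrite subnS; apply: is_layer_closure; first by lia.
by apply: IH; lia.
Qed.

(** * Segments, extreme elements and deletions in terms of ordinals *)

Lemma in_seg a b x : (x \in seg n a b) = (a <= x.+1 <= b).
Proof. by rewrite inE. Qed.

Lemma seg_subset A a b : seg n a b \subset A ->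
  forall x, a <= x.+1 <= b -> x \in A.
Proof. by move=> /subsetP H x xab; apply: H; rewrite in_seg. Qed.

Lemma subset_seg A a b : A \subset seg n a b ->
  forall x, x \in A -> a <= x.+1 <= b.
Proof. by move=> /subsetP H x /H; rewrite in_seg. Qed.

Lemma meets_seg A a b : A :&: seg n a b <> set0 ->
  exists2 x, x \in A & a <= x.+1 <= b.
Proof. by move=> /eqP/set0Pn[x]; rewrite !inE => /andP[]; exists x. Qed.

Lemma max_eltP A : A != set0 ->
  exists2 y, y \in A & lbl y = max_elt A /\ forall z, z \in A -> z <= y.
Proof.
case/set0Pn=> x xA; have A0 : 0 < #|A| by rewrite card_gt0; apply/set0Pn; exists x.
have [y yA e] := eq_bigmax_cond (@lbl n) A0.
by exists y => //; split=> // z zA; rewrite -ltnS -[y.+1]e; apply: leq_bigmax_cond.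
Qed.

Lemma min_eltP A : A != set0 ->
  exists2 y, y \in A & lbl y = min_elt A /\ forall z, z \in A -> y <= z.
Proof.
case/set0Pn=> x xA.
have [y yA ymin] : exists2 y, y \in A & forall z, z \in A -> y <= z.
  by case: (arg_minnP (@nat_of_ord n) xA) => y; exists y.
exists y => //; split=> //; apply/eqP; rewrite eqn_leq; apply/andP; split.
  (* The initial value [n] of the fold is at least every label, so the lower bound survives it. *)
  rewrite /min_elt; elim/big_ind: _ => [|a b ya yb|z zA]; first exact: ltn_ord.
    by rewrite leq_min ya yb.
  by rewrite ltnS ymin.
rewrite /min_elt; have := mem_index_enum y; elim: (index_enum _) => // z r IH.
rewrite big_cons inE => /orP[/eqP <-|/IH le]; first by rewrite yA geq_minl.
by case: ifP => // _; rewrite geq_min le orbT.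
Qed.

Lemma del_lbl A y : del A (lbl y) = A :\ y.
Proof.
apply/setP => z; rewrite !inE andbC /lbl eqSS.
by congr (_ && _); apply: negb_inj; rewrite !negbK.
Qed.

Lemma layer_card2 m A : layer m A -> A \notin path_family n -> m = #|A|.+2 ->
  isolated_extremal A.
Proof. by move=> [_ [->|||[]]] //; lia. Qed.

End Layers.

(** * The fourteen conditions checked against the layer of index n - k *)

Theorem theorem3 (n : nat) (hn : 6 <= n) (k : nat) (hk0 : 0 < k)
    (hk : k <= n - 5) (A : {set 'I_n}) (hAF : A \notin path_family n)
    (hA : #|A| <= n - k - 1) :
  ( (* (i) *)
    (seg n 1 1 \subset A /\ A \subset seg n 1 1 :|: seg n 3 n)
    \/ (* (ii) *)
    (seg n n n \subset A /\ A \subset seg n 1 (n - 2) :|: seg n n n)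
    \/ (* (vii) *)
    [/\ A \subset seg n 1 (n - 2), A :&: seg n 1 2 <> set0,
        #|A| = n - k - 2 & del A (max_elt A) \notin path_family n]
    \/ (* (viii) *)
    [/\ A \subset seg n 3 n, A :&: seg n (n - 1) n <> set0,
        #|A| = n - k - 2 & del A (min_elt A) \notin path_family n]
    \/ (* (ix) *)
    [/\ #|A| = n - k - 2, A :&: seg n 1 2 <> set0
      & A :&: seg n (n - 1) n <> set0]
    \/ (* (xii) *)
    [/\ A \subset seg n 3 (n - 2), #|A| = n - k - 2
      & exists j : 'I_n, [/\ j \in A, min_elt A < lbl j < max_elt A,
          ~~ has_elt A (lbl j - 1) & ~~ has_elt A (lbl j + 1)]]
    \/ (* (xiv) *)
    #|A| <= n - k - 3
    -> A \notin iter_closure k (path_family n))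
  /\
  ( (* (iii) *)
    [/\ seg n 1 2 \subset A, A \subset seg n 1 (n - 1) & #|A| = n - k - 1]
    \/ (* (iv) *)
    [/\ seg n (n - 1) n \subset A, A \subset seg n 2 n & #|A| = n - k - 1]
    \/ (* (v) *)
    (A \subset seg n 2 (n - 1) /\ #|A| = n - k - 1)
    \/ (* (vi) *)
    (seg n 1 2 :|: seg n (n - 1) n \subset A /\ #|A| = n - k - 1)
    \/ (* (x) *)
    [/\ A \subset seg n 1 (n - 2), #|A| = n - k - 2
      & del A (max_elt A) \in path_family n]
    \/ (* (xi) *)
    [/\ A \subset seg n 3 n, #|A| = n - k - 2
      & del A (min_elt A) \in path_family n]
    \/ (* (xiii) *)
    [/\ A \subset seg n 3 (n - 2), #|A| = n - k - 2
      & forall j : 'I_n, j \in A -> min_elt A < lbl j < max_elt A ->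
          has_elt A (lbl j - 1) \/ has_elt A (lbl j + 1)]
    -> A \in iter_closure k (path_family n)).
Proof.
have LG := is_layer_iter hk (ltnW hn).
have m4 : 3 < n - k by lia.
have lt : #|A| < n - k by lia.
have out x : isolated A x -> ~ 0 < x < n.-1 -> A \notin iter_closure k (path_family n).
  by move=> isox nx; apply/negP => /LG LA; apply: nx; apply: layer_inside LA lt x isox.
have out2 : #|A| = n - k - 2 -> (isolated_extremal A -> False) ->
    A \notin iter_closure k (path_family n).
  move=> e H; apply/negP => /LG LA; apply: H; apply: layer_card2 LA hAF _; lia.
have nz i : #|A| = n - k - i -> i <= 2 -> A != set0.
  by rewrite -card_gt0 => -> ?; lia.
split.
- case=> [[A1 /subsetP A2]|[[A1 /subsetP A2]|[|[|[|[|]]]]]].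
  + have n0 : 0 < n by lia.
    apply: (out (Ordinal n0)) => //; apply/isolatedP; split.
      by apply: (seg_subset A1).
    by move=> y /A2; rewrite inE !in_seg /adj /=; lia.
  + have n0 : n.-1 < n by lia.
    apply: (out (Ordinal n0)); last by rewrite /=; lia.
    apply/isolatedP; split; first by apply: (seg_subset A1); rewrite /=; lia.
    by move=> y /A2; rewrite inE !in_seg /adj /=; lia.
  + move=> [/subset_seg A1 /meets_seg[u uA u12] cA ndel]; apply: out2 => // ext.
    have [x isox] := not_path_family_isolated (nz _ cA isT) hAF.
    have [y yA [ymax maxy]] := max_eltP (nz _ cA isT).
    have iso_y z : isolated A z -> z = y.
      move=> isoz; have /isolatedP[zA _] := isoz; apply: val_inj; apply/eqP.
      (* A tolerated minimum has label at least 3, but [u] has label at most 2; so [z] is the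
         maximum. *)
      case: (ext z isoz) => -[zb H]; last by have := H u uA; lia.
      by rewrite eqn_leq maxy // H.
    rewrite -ymax del_lbl in ndel; case/negP: ndel; apply/path_familyP; split.
      by apply: setD1_neq0 => //; lia.
    move=> z; apply/negP => /isolatedP[/setD1P[zy zA] nadj].
    case/eqP: zy; apply: (iso_y z); apply/isolatedP; split=> // v vA.
    (* The deleted [y] is the isolated [x], so its removal cannot be what isolates [z]. *)
    have [->|vy] := eqVneq v y; last by apply: nadj; rewrite !inE vy.
    by have /isolatedP[_] := isox; rewrite (iso_y x isox) adjC; apply.
  + move=> [/subset_seg A1 /meets_seg[u uA u12] cA ndel]; apply: out2 => // ext.
    have [x isox] := not_path_family_isolated (nz _ cA isT) hAF.
    have [y yA [ymin miny]] := min_eltP (nz _ cA isT).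
    have iso_y z : isolated A z -> z = y.
      move=> isoz; have /isolatedP[zA _] := isoz; apply: val_inj; apply/eqP.
      case: (ext z isoz) => -[zb H]; first by have := H u uA; lia.
      by rewrite eqn_leq miny // H.
    rewrite -ymin del_lbl in ndel; case/negP: ndel; apply/path_familyP; split.
      by apply: setD1_neq0 => //; lia.
    move=> z; apply/negP => /isolatedP[/setD1P[zy zA] nadj].
    case/eqP: zy; apply: (iso_y z); apply/isolatedP; split=> // v vA.
    have [->|vy] := eqVneq v y; last by apply: nadj; rewrite !inE vy.
    by have /isolatedP[_] := isox; rewrite (iso_y x isox) adjC; apply.
  + move=> [cA /meets_seg[u uA u12] /meets_seg[v vA vn]]; apply: out2 => // ext.
    have [x isox] := not_path_family_isolated (nz _ cA isT) hAF.
    (* A tolerated maximum would lie below [v], a tolerated minimum above [u]. *)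
    by case: (ext x isox) => -[xb H]; have := H u uA; have := H v vA; lia.
  + move=> [_ cA [j [jA jmm j1 j2]]]; apply: out2 => // ext.
    have isoj : isolated A j by rewrite isolated_has_elt jA j1.
    have [y yA [ymax _]] := max_eltP (nz _ cA isT).
    have [z zA [zmin _]] := min_eltP (nz _ cA isT).
    rewrite -ymax -zmin /lbl in jmm.
    by case: (ext j isoj) => -[xb H]; have := H y yA; have := H z zA; lia.
  move=> cA; apply/negP => /LG LA.
  have [x isox] := not_path_family_isolated LA.1 hAF.
  by apply: not_layer_small isox _ LA; lia.
have in1 : #|A| = n - k - 1 -> isolated_inside A -> A \in iter_closure k (path_family n).
  move=> cA ins; apply/LG; split; first exact: nz cA isT.
  by constructor 3; split=> //; lia.
have in2 : #|A| = n - k - 2 -> isolated_extremal A -> A \in iter_closure k (path_family n).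
  move=> cA ext; apply/LG; split; first exact: nz cA isT.
  by constructor 4; split=> //; lia.
(* The only value to exclude is 0, whose neighbour, labelled 2, is in [A]; [stop] is the mirror
   image. *)
have start x : (forall y : 'I_n, y < 2 -> y \in A) -> isolated A x -> 0 < x.
  move=> H /isolatedP[xA nadj]; have n1 : 1 < n by lia.
  by have := nadj (Ordinal n1) (H (Ordinal n1) isT); rewrite /adj /=; lia.
have stop x : (forall y : 'I_n, n - 2 <= y -> y \in A) -> isolated A x -> x < n.-1.
  move=> H /isolatedP[_ nadj]; have n1 : n - 2 < n by lia.
  have := nadj (Ordinal n1) (H (Ordinal n1) (leqnn _)); rewrite /adj /=.
  by have := ltn_ord x; lia.
case=> [|[|[|[|[|[|]]]]]].
- move=> [/seg_subset A1 /subset_seg A2 cA]; apply: in1 => // x isox.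
  have /isolatedP[/A2 xA _] := isox.
  have x0 : 0 < x by apply: start isox => y y2; apply: A1; lia.
  by lia.
- move=> [/seg_subset A1 /subset_seg A2 cA]; apply: in1 => // x isox.
  have /isolatedP[/A2 xA _] := isox.
  have x1 : x < n.-1.
    by apply: stop isox => y y2; apply: A1; have := ltn_ord y; lia.
  by lia.
- move=> [/subset_seg A1 cA]; apply: in1 => // x /isolatedP[/A1 + _]; lia.
- move=> [A1 cA]; apply: in1 => // x isox; have /subUsetP[/seg_subset A2 /seg_subset A3] := A1.
  have x0 : 0 < x by apply: start isox => y y2; apply: A2; lia.
  rewrite x0; apply: stop isox => y y2; apply: A3; have := ltn_ord y; lia.
- move=> [/subset_seg A1 cA]; have [y yA [<- maxy]] := max_eltP (nz _ cA isT).
  rewrite del_lbl => /path_familyP[_ H]; apply: in2 => // x isox.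
  have /isolatedP[xA _] := isox.
  have [->|xy] := eqVneq x y; first by left; split=> //; have := A1 y yA; lia.
  (* An isolated element other than the maximum would stay isolated once the maximum is deleted. *)
  case/negP: (H x); apply: isolated_sub isox; first exact: subsetDl.
  by rewrite !inE xy.
- move=> [/subset_seg A1 cA]; have [y yA [<- miny]] := min_eltP (nz _ cA isT).
  rewrite del_lbl => /path_familyP[_ H]; apply: in2 => // x isox.
  have /isolatedP[xA _] := isox.
  have [->|xy] := eqVneq x y; first by right; split=> //; have := A1 y yA; lia.
  case/negP: (H x); apply: isolated_sub isox; first exact: subsetDl.
  by rewrite !inE xy.
move=> [/subset_seg A1 cA H]; apply: in2 => // x isox.
have [y yA [ymax maxy]] := max_eltP (nz _ cA isT).
have [z zA [zmin minz]] := min_eltP (nz _ cA isT).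
move: isox (H x); rewrite isolated_has_elt => /and3P[xA /negPf-> /negPf->].
rewrite -ymax -zmin /lbl => /(_ xA) {}H.
have [xy|xy] := leqP y x.
  by left; split; [have := A1 x xA; lia | move=> u /maxy; lia].
right; split; first by have := A1 x xA; lia.
have zx := minz x xA; have [xz|xz] := leqP x z; first by move=> u /minz; lia.
by have [] : false \/ false by apply: H; lia.
Qed.
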